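(* Let $f\colon X\rightarrow Y$ be a continuous surjection between compact Hausdorff spaces, and let $f_*\colon\mathfrak{M}(X)\rightarrow\mathfrak{M}(Y)$, $\mu\mapsto\mu\circ f^{-1}$, be the induced map. Then: (1) If $f$ is semi-open and densely open, then $f_*$ is semi-open and densely open. (2) If $f$ is densely open, then $f_*$ is densely open.
   Context: For a compact Hausdorff space $Z$, $\mathfrak{M}(Z)$ denotes the set of all regular Borel probability measures on $Z$, equipped with the weak-$*$ topology; it is a compact Hausdorff space. A continuous surjection $f\colon X\to Y$ of compact Hausdorff spaces induces a continuous surjection $f_*\colon\mathfrak{M}(X)\to\mathfrak{M}(Y)$, $\mu\mapsto\mu\circ f^{-1}$ (push-forward of measures). For a compact Hausdorff space $A$, the hyperspace $2^A$ is the collection of all non-empty closed subsets of $A$ equipped with the Vietoris topology, a base of which is formed by the sets $\langle U_1,\dotsc,U_n\rangle:=\{K\in 2^A\mid K\subseteq U_1\cup\dotsm\cup U_n,\ K\cap U_i\neq\emptyset,\ 1\le i\le n\}$ for all $n\ge 1$ and all non-empty open sets $U_1,\dotsc,U_n$ in $A$. Let $g\colon A\to B$ be a continuous surjection between compact Hausdorff spaces. It is semi-open if for every non-empty open subset $U$ of $A$, the interior of $g[U]$ in $B$ is non-empty. It is densely open if there exists a dense set $B_o\subseteq B$ such that the map $g^{-1}\colon B\to 2^A$, $b\mapsto g^{-1}(b)$, is continuous at each point of $B_o$. *)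

(* Defs.v *)
From HB Require Import structures.
From mathcomp Require Import all_boot all_order all_algebra.
From mathcomp Require Import all_classical all_reals all_analysis.

Set Implicit Arguments.
Unset Strict Implicit.
Unset Printing Implicit Defensive.
Import Order.TTheory GRing.Theory Num.Theory.
Import numFieldNormedType.Exports.
Local Open Scope classical_set_scope.
Local Open Scope ring_scope.

Section hyperspace.
Variable A : topologicalType.

Record hyperspace := Hyperspace {
  hset :> set A ;
  hset_closed : closed hset ;
  hset_nonempty : hset !=set0 }.

HB.instance Definition _ := gen_eqMixin hyperspace.
HB.instance Definition _ := gen_choiceMixin hyperspace.

(* <U_1, ..., U_n> for s = [:: U_1; ...; U_n] *)
Definition vietoris (s : seq (set A)) : set hyperspace :=
  [set K : hyperspace | K `<=` \bigcup_(U in [set` s]) U /\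
                        forall U, U \in s -> K `&` U !=set0].

Definition vietoris_base : set (set hyperspace) :=
  [set vietoris s | s in [set s : seq (set A) |
     (0 < size s)%N /\ forall U, U \in s -> open U /\ U !=set0]].

Let vietoris_cover : \bigcup_(W in vietoris_base) W = [set: hyperspace].
Proof.
apply/seteqP; split=> // K _; have [x Kx] := hset_nonempty K.
exists (vietoris [:: setT]).
  exists [:: setT] => //; split=> // U; rewrite inE => /eqP ->.
  by split; [exact: openT|exists x].
split; first by move=> y _; exists setT => //=; rewrite inE.
by move=> U; rewrite inE => /eqP ->; exists x.
Qed.

Let vietoris_join (W1 W2 : set hyperspace) (K : hyperspace) :
  vietoris_base W1 -> vietoris_base W2 -> W1 K -> W2 K ->
  exists W, [/\ vietoris_base W, W K & W `<=` W1 `&` W2].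
Proof.
move=> [s [s0 sP] <-] [t [t0 tP] <-] [Ks sK] [Kt tK].
have opU (r : seq (set A)) : (forall U, U \in r -> open U /\ U !=set0) ->
    open (\bigcup_(U in [set` r]) U).
  by move=> rP; apply: bigcup_open => U /rP[].
set S := \bigcup_(U in [set` s]) U; set T := \bigcup_(U in [set` t]) U.
pose r := [seq U `&` T | U <- s] ++ [seq U `&` S | U <- t].
have rE U : U \in r -> (exists2 V, V \in s & U = V `&` T) \/
                       (exists2 V, V \in t & U = V `&` S).
  by rewrite mem_cat => /orP[] /mapP[V Vs ->]; [left|right]; exists V.
have rK U : U \in r -> K `&` U !=set0.
  move=> /rE[] [V Vi ->]; [have [x [Kx Vx]] := sK _ Vi|
                           have [x [Kx Vx]] := tK _ Vi]; exists x; split=> //.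
  - by split=> //; exact: Kt.
  - by split=> //; exact: Ks.
exists (vietoris r); split.
- exists r => //; split; first by rewrite size_cat size_map ltn_addr.
  move=> U Ur; split; last by have [x [_ Ux]] := rK U Ur; exists x.
  case: (rE U Ur) => [] [V Vi ->]; apply: openI.
  + by have [] := sP _ Vi.
  + exact: opU.
  + by have [] := tP _ Vi.
  + exact: opU.
- split=> // x Kx; have [U sU Ux] := Ks x Kx; exists (U `&` T).
    by rewrite /= mem_cat; apply/orP; left; exact: (map_f (setI^~ T)).
  by split=> //; exact: Kt.
- move=> L [Lr rL]; split; split.
  + move=> x /Lr[U /rE[] [V Vi ->] [Vx Sx]]; last exact: Sx.
    by exists V.
  + move=> U sU; have [|x [Lx [Ux _]]] := rL (U `&` T); last by exists x.
    by rewrite mem_cat; apply/orP; left; exact: (map_f (setI^~ T)).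
  + move=> x /Lr[U /rE[] [V Vi ->] [Vx Sx]]; first exact: Sx.
    by exists V.
  + move=> U tU; have [|x [Lx [Ux _]]] := rL (U `&` S); last by exists x.
    by rewrite mem_cat; apply/orP; right; exact: (map_f (setI^~ S)).
Qed.

HB.instance Definition _ := isBaseTopological.Build hyperspace
  vietoris_cover vietoris_join.

End hyperspace.

Definition semi_open (A B : topologicalType) (g : A -> B) : Prop :=
  forall U : set A, open U -> U !=set0 -> (g @` U)° !=set0.

(* The map b |-> g^-1(b) is well defined into the hyperspace exactly when the
   fibres of g are closed and non-empty, e.g. when g is a continuous
   surjection onto a Hausdorff space; it is then unique, so the quantifier
   over F only names it. *)
Definition densely_open (A B : topologicalType) (g : A -> B) : Prop :=
  exists2 F : B -> hyperspace A,
    (forall b, F b = g @^-1` [set b] :> set A) &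
    exists2 B0 : set B, dense B0 & forall b, B0 b -> {for b, continuous F}.

(* Measurable types are pointed in the library, hence so is Z below; this only
   excludes the empty space. *)
Notation borel Z := (g_sigma_algebraType (@open Z)).

Section regular_probability.
Variables (R : realType) (Z : ptopologicalType).

Definition regular_measure (mu : set Z -> \bar R) : Prop :=
  forall B : set (borel Z), measurable B ->
    mu B = ereal_inf [set mu U | U in [set U | open U /\ B `<=` U]] /\
    mu B = ereal_sup [set mu K | K in [set K | compact K /\ K `<=` B]].

(* A library measure also takes values on non-measurable sets, and those are
   unconstrained.  rprob_outer pins them to the outer measure, so that two
   regular Borel probability measures are equal as soon as they agree on Borel
   sets (regular_probability_eq), at no loss (regular_probability_ex). *)
Record regular_probability := RegularProbability {
  rprob :> probability (borel Z) R ;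
  rprob_regular : regular_measure rprob ;
  rprob_outer : forall A : set Z,
    rprob A = ereal_inf [set rprob U | U in [set U | open U /\ A `<=` U]] }.

Lemma regular_probability_eq (mu nu : regular_probability) :
  (forall B : set (borel Z), measurable B -> mu B = nu B) -> mu = nu.
Proof.
move=> munu.
have {munu} E : mu = nu :> (set (borel Z) -> \bar R).
  apply/funext => A; rewrite (rprob_outer mu A) (rprob_outer nu A).
  congr (ereal_inf _); apply: eq_imagel => U [oU _].
  by apply: munu; exact: sub_sigma_algebra.
case: mu nu E => [[m cm] rm om] [[n cn] rn on] /= E; subst n.
have E : cm = cn.
  move: cm cn {rm om rn on} => [[a1 b1] [c1] [d1] [e1] [f1] [g1] [h1]].
  move=> [[a2 b2] [c2] [d2] [e2] [f2] [g2] [h2]].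
  by rewrite (Prop_irrelevance a1 a2) (Prop_irrelevance b1 b2)
    (Prop_irrelevance c1 c2) (Prop_irrelevance d1 d2) (Prop_irrelevance e1 e2)
    (Prop_irrelevance f1 f2) (Prop_irrelevance g1 g2) (Prop_irrelevance h1 h2).
by subst cn; f_equal; exact: Prop_irrelevance.
Qed.

Section outer_extension.
Variable P : probability (borel Z) R.
Hypotheses (hZ : hausdorff_space Z) (rP : regular_measure P).

Let Q (A : set (borel Z)) : \bar R :=
  ereal_inf [set P U | U in [set U : set Z | open U /\ A `<=` U]].

Let QE B : measurable B -> Q B = P B.
Proof. by move=> /rP[]. Qed.

Let Q0 : Q set0 = 0%E.
Proof. by rewrite QE ?measure0. Qed.

Let Q_ge0 A : (0 <= Q A)%E.
Proof. by apply: le_ereal_inf_tmp => _ [U _ <-]; exact: measure_ge0. Qed.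

Let Q_sigma_additive : semi_sigma_additive Q.
Proof.
move=> F mF tF mUF; rewrite QE//.
rewrite (_ : (fun n => _) = (fun n => \sum_(0 <= i < n) P (F i))%E).
  exact: measure_semi_sigma_additive.
by apply/funext => n; apply: eq_bigr => i _; rewrite QE.
Qed.

HB.instance Definition _ :=
  isMeasure.Build _ _ _ Q Q0 Q_ge0 Q_sigma_additive.

Let QT : Q setT = 1%E.
Proof. by rewrite QE ?probability_setT. Qed.

HB.instance Definition _ := Measure_isProbability.Build _ _ _ Q QT.

Lemma regular_probability_ex : exists mu : regular_probability,
  forall B : set (borel Z), measurable B -> mu B = P B.
Proof.
have mo (U : set Z) : open U -> measurable (U : set (borel Z)).
  by move=> oU; exact: sub_sigma_algebra.
have mc (K : set Z) : compact K -> measurable (K : set (borel Z)).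
  move=> /(compact_closed hZ) cK; rewrite -[K]setCK.
  by apply: measurableC; apply: mo; exact: closed_openC.
have outerQ A : Q A = ereal_inf [set Q U | U in [set U | open U /\ A `<=` U]].
  congr (ereal_inf _); apply: eq_imagel => U [oU _].
  by rewrite QE//; exact: mo.
have rQ : regular_measure Q.
  move=> B mB; split; first exact: outerQ.
  rewrite QE// (rP mB).2; congr (ereal_sup _); apply: eq_imagel => K [cK _].
  by rewrite QE//; exact: mc.
by exists (RegularProbability rQ outerQ) => B mB; exact: QE.
Qed.

End outer_extension.

HB.instance Definition _ := gen_eqMixin regular_probability.
HB.instance Definition _ := gen_choiceMixin regular_probability.

(* The weak-* topology is the coarsest one making mu |-> \int phi dmu
   continuous for every real continuous function phi on Z. *)
Definition functional_of (mu : regular_probability) :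
    {ptws continuousType Z R -> R} :=
  fun phi => \int[mu]_(x in [set: borel Z]) (phi x : R).

HB.instance Definition _ := Topological.copy regular_probability
  (initial_topology functional_of).

End regular_probability.

Section pushforward_regular.
Variables (R : realType) (X Y : ptopologicalType) (f : X -> Y).
Hypotheses (cX : compact [set: X]) (hX : hausdorff_space X)
  (hY : hausdorff_space Y) (cf : continuous f).

Lemma continuous_borel_measurable :
  measurable_fun [set: borel X] (f : borel X -> borel Y).
Proof.
apply: (@measurability _ _ (borel X) (borel Y) _ _ (@open Y)) => // _ [U oU <-].
by rewrite setTI; apply: sub_sigma_algebra; move/continuousP: cf; apply.
Qed.

Variable mu : regular_probability R X.

(* the library's pushforward of mu, as a probability measure *)
Definition push_prob : probability (borel Y) R :=
  distribution mu (mfun_Sub (mem_set continuous_borel_measurable)).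

Let mo (T : ptopologicalType) (U : set T) :
  open U -> measurable (U : set (borel T)).
Proof. by move=> oU; exact: sub_sigma_algebra. Qed.

Let mc (T : ptopologicalType) (U : set T) :
  closed U -> measurable (U : set (borel T)).
Proof.
by move=> cU; rewrite -[U]setCK; apply: measurableC; apply: mo;
  exact: closed_openC.
Qed.

Let cpt (K : set X) : compact K -> compact (f @` K).
Proof. by apply: continuous_compact; exact: continuous_subspaceT. Qed.

Let le_mu (C D : set (borel X)) :
  measurable C -> measurable D -> C `<=` D -> (mu C <= mu D)%E.
Proof. by move=> mC mD CD; apply: le_measure; rewrite ?inE. Qed.

Lemma push_prob_outer (A : set Y) : push_prob A =
  ereal_inf [set push_prob U | U in [set U | open U /\ A `<=` U]].
Proof.
rewrite [LHS](rprob_outer mu (f @^-1` A)).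
apply/eqP; rewrite eq_le; apply/andP; split.
  apply: le_ereal_inf_tmp => _ [U [oU AU] <-]; apply: ereal_inf_lbound.
  exists (f @^-1` U) => //; split; last exact: preimage_subset.
  by move/continuousP: cf; apply.
apply: le_ereal_inf_tmp => _ [V [oV AV] <-].
pose U : set Y := ~` (f @` ~` V).
have oU : open U.
  apply: closed_openC; apply: compact_closed hY _; apply: cpt.
  by apply: (subclosed_compact _ cX) => //; exact: open_closedC.
apply: ge_ereal_inf; exists (mu (f @^-1` U)).
  exists U => //; split=> // y Ay [x nVx fxy]; apply: nVx.
  by apply: AV; rewrite /preimage /= fxy.
apply: le_mu; [apply: mo|exact: mo|]; first by move/continuousP: cf; apply.
by move=> x Ux; apply: contrapT => nVx; apply: Ux; exists x.
Qed.

Lemma push_prob_regular : regular_measure push_prob.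
Proof.
move=> B mB; split; first exact: push_prob_outer.
rewrite /push_prob /distribution /pushforward /=.
have mf (C : set (borel Y)) :
    measurable C -> measurable (f @^-1` C : set (borel X)).
  move=> mC; rewrite -[X in measurable X]setTI.
  exact: continuous_borel_measurable.
apply/eqP; rewrite eq_le; apply/andP; split; last first.
  apply: ge_ereal_sup => _ [K [cK KB] <-].
  have clK : closed K by exact: compact_closed.
  by apply: le_mu; [apply: mf; exact: mc|exact: mf|exact: preimage_subset].
rewrite [leLHS](rprob_regular mu (mf _ mB)).2.
apply: ge_ereal_sup => _ [K [cK KB] <-].
have clK : closed (f @` K) by apply: compact_closed => //; exact: cpt.
apply: le_ereal_sup_tmp; exists (mu (f @^-1` (f @` K))).
  by exists (f @` K) => //; split; [exact: cpt|move=> _ [x Kx <-]; exact: KB].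
apply: le_mu; first by apply: mc; exact: compact_closed.
  by apply: mf; exact: mc.
by move=> x Kx; exists x.
Qed.

Definition pushforward_regular : regular_probability R Y :=
  RegularProbability push_prob_regular push_prob_outer.

End pushforward_regular.

(* Main.v *)
(** The sets [{mu | a < mu U}], [U] open, form a subbase of the weak-* topology,
    so the whole argument is carried out with masses of open sets. Limits along
    ultrafilters of [mu K], [K] closed, are contents; extending them by
    Caratheodory's method gives compactness of the space of measures. Measures
    with finite support in a given dense set are dense, because replacing each
    atom of the algebra generated by finitely many open sets by a point of that
    atom, moved slightly into the dense set, does not decrease their masses.

    Let [Y0] be a dense set of continuity points of [y |-> f^-1(y)]: [f] is open
    at each point of the fibres over [Y0]. If [nu = f_* mu] has finite support in
    [Y0], cut [mu] into its restrictions to the fibres of the atoms of [nu]. Each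
    piece is approximated by a measure on every nearby fibre, and gluing these
    along a finitely supported [nu'] close to [nu] yields [mu'] close to [mu] with
    [f_* mu' = nu']. As [f_*] maps closed sets to closed sets, this extends to all
    [nu'] close to [nu]; so [f_*] is open at every point of the fibre of [nu].
    If [f] is moreover semi-open, [f^-1(Y0)] is dense, hence measures
    with finite support in it are dense, and [f_*] is open at each of them. *)
Require Import Defs.
From HB Require Import structures.
From mathcomp Require Import all_boot all_order all_algebra.
From mathcomp Require Import all_classical all_reals all_analysis.
From mathcomp Require Import lra.
Set Implicit Arguments.
Unset Strict Implicit.
Unset Printing Implicit Defensive.
Import Order.TTheory GRing.Theory Num.Theory.
Import numFieldNormedType.Exports.
Local Open Scope classical_set_scope.
Local Open Scope ring_scope.

(** * Real-valued masses of sets and their regularity *)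

Section mass.
Variables (R : realType) (Z : ptopologicalType).
Implicit Types (mu nu : regular_probability R Z) (A B U K : set Z).

Lemma open_borel U : open U -> measurable (U : set (borel Z)).
Proof. by move=> oU; exact: sub_sigma_algebra. Qed.

Lemma closed_borel K : closed K -> measurable (K : set (borel Z)).
Proof.
by move=> cK; rewrite -[K]setCK; apply: measurableC; apply: open_borel;
  exact: closed_openC.
Qed.

Definition mass mu A : R := fine (mu A).

(** Monotone on arbitrary sets, because [rprob_outer] makes both sides infima over open
    supersets. *)
Lemma rprob_le mu A B : A `<=` B -> (mu A <= mu B)%E.
Proof.
move=> AB; rewrite (rprob_outer mu A) (rprob_outer mu B).
apply: ereal_inf_le_tmp => _ [U [oU BU] <-]; exists U => //; split=> //.
exact: subset_trans BU.
Qed.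

Lemma massE mu A : (mass mu A)%:E = mu A.
Proof.
rewrite /mass fineK// ge0_fin_numE ?measure_ge0//.
apply: (@le_lt_trans _ _ (mu setT)); first exact: rprob_le.
by rewrite probability_setT ltry.
Qed.

Lemma mass_ge0 mu A : 0 <= mass mu A.
Proof. by rewrite -lee_fin massE measure_ge0. Qed.

Lemma le_mass mu A B : A `<=` B -> mass mu A <= mass mu B.
Proof. by move=> AB; rewrite -lee_fin !massE rprob_le. Qed.

Lemma massT mu : mass mu setT = 1.
Proof. by rewrite /mass probability_setT. Qed.

Lemma mass_le1 mu A : mass mu A <= 1.
Proof. by rewrite -(massT mu) le_mass. Qed.

Lemma mass0 mu : mass mu set0 = 0.
Proof. by rewrite /mass measure0. Qed.

Lemma massU mu A B : measurable (A : set (borel Z)) ->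
  measurable (B : set (borel Z)) -> A `&` B = set0 ->
  mass mu (A `|` B) = mass mu A + mass mu B.
Proof.
by move=> mA mB AB; apply: EFin_inj; rewrite EFinD !massE -measureU.
Qed.

Lemma massC mu A : measurable (A : set (borel Z)) ->
  mass mu (~` A) = 1 - mass mu A.
Proof.
move=> mA; have mC : measurable (~` A : set (borel Z)) by exact: measurableC.
by rewrite -(massT mu) -(setUv A) (massU _ mA mC) ?setICr//; lra.
Qed.

Lemma massU2 mu A B : measurable (A : set (borel Z)) ->
  measurable (B : set (borel Z)) -> mass mu (A `|` B) <= mass mu A + mass mu B.
Proof. by move=> mA mB; rewrite -lee_fin EFinD !massE; exact: measureU2. Qed.

Lemma mass_outer mu A (e : R) : 0 < e ->
  exists U, [/\ open U, A `<=` U & mass mu U < mass mu A + e].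
Proof.
move=> e0; have : (mu A < (mass mu A + e)%:E)%E by rewrite -massE lte_fin ltrDl.
rewrite (rprob_outer mu A) => /ereal_inf_lt[_ [U [oU AU] <-] lt].
by exists U; split=> //; rewrite -lte_fin massE.
Qed.

Lemma mass_inner mu A (a : R) : measurable (A : set (borel Z)) ->
  a < mass mu A -> exists K, [/\ compact K, K `<=` A & a < mass mu K].
Proof.
move=> mA; rewrite -lte_fin massE (rprob_regular mu mA).2.
move=> /ereal_sup_gt[_ [K [cK KA] <-] lt]; exists K; split=> //.
by rewrite -lte_fin massE.
Qed.

(** Outer regularity carries the inequality from open sets to all sets; applied to the complement of
    a Borel set it turns around, since both total masses are 1. *)
Lemma le_mass_open_eq mu nu :
  (forall U, open U -> mass mu U <= mass nu U) -> mu = nu.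
Proof.
move=> le_op.
have le_all A : mass mu A <= mass nu A.
  apply/ler_addgt0Pr => e e0; have [U [oU AU ltU]] := mass_outer nu A e0.
  by apply: le_trans (ltW ltU); apply: le_trans (le_op _ oU); exact: le_mass.
apply: regular_probability_eq => B mB; rewrite -!massE; congr _%:E.
apply/eqP; rewrite eq_le le_all/=.
by have := le_all (~` B); rewrite !massC//; lra.
Qed.

End mass.

(** * From contents on closed sets to regular Borel measures *)

Section content.
Variables (R : realType) (Z : ptopologicalType).
Hypotheses (cZ : compact [set: Z]) (hZ : hausdorff_space Z).
Variable lam : set Z -> R.
Hypotheses (lam_ge0 : forall K, 0 <= lam K)
  (le_lam : forall K L, closed K -> closed L -> K `<=` L -> lam K <= lam L)
  (lamUle : forall K L, closed K -> closed L -> lam (K `|` L) <= lam K + lam L)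
  (lamU : forall K L, closed K -> closed L -> K `&` L = set0 ->
    lam K + lam L <= lam (K `|` L))
  (lamT : lam setT = 1).

Let closed_cpt (K : set Z) : closed K -> compact K.
Proof. by move=> cK; apply: (subclosed_compact cK cZ). Qed.

Let lam0 : lam set0 = 0.
Proof.
have := lamU closed0 closed0 (setI0 _); have := lam_ge0 set0.
by rewrite setU0; lra.
Qed.

(** The inner content, meant for open sets; [outer] below is the outer measure it induces. *)
Let rho (U : set Z) : \bar R :=
  ereal_sup [set (lam K)%:E | K in [set K | closed K /\ K `<=` U]].

Let outer (A : set Z) : \bar R :=
  ereal_inf [set rho U | U in [set U | open U /\ A `<=` U]].

Let le_rho U V : U `<=` V -> (rho U <= rho V)%E.
Proof.
move=> UV; apply: ereal_sup_le => _ [K [cK KU] <-]; exists K => //; split=> //.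
exact: subset_trans UV.
Qed.

Let lam_rho K U : closed K -> K `<=` U -> ((lam K)%:E <= rho U)%E.
Proof. by move=> cK KU; apply: ereal_sup_ubound; exists K. Qed.

Let rho_ge0 U : (0 <= rho U)%E.
Proof.
have -> : 0%E = (lam set0)%:E by rewrite lam0.
by apply: lam_rho => //; exact: closed0.
Qed.

Let outer_open U : open U -> outer U = rho U.
Proof.
move=> oU; apply/eqP; rewrite eq_le; apply/andP; split.
  by apply: ereal_inf_lbound; exists U => //; split=> //; exact: subset_refl.
by apply: le_ereal_inf_tmp => _ [V [oV UV] <-]; exact: le_rho.
Qed.

Let rho0 : rho set0 = 0%E.
Proof.
apply/eqP; rewrite eq_le rho_ge0 andbT; apply: ge_ereal_sup => _ [K [_ K0] <-].
by rewrite (_ : K = set0) ?lam0//; apply/seteqP; split.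
Qed.

Let outer0 : outer set0 = 0%E.
Proof. by rewrite outer_open ?rho0//; exact: open0. Qed.

Let outer_ge0 A : (0 <= outer A)%E.
Proof. by apply: le_ereal_inf_tmp => _ [U _ <-]. Qed.

Let le_outer : {homo outer : A B / A `<=` B >-> (A <= B)%E}.
Proof.
move=> A B AB; apply: ereal_inf_le_tmp => _ [U [oU BU] <-]; exists U => //.
by split=> //; exact: subset_trans BU.
Qed.

(** Induction on [n]. With [V] the union of the first [n] sets, [K] minus [U n] and [K] minus [V]
    are closed and disjoint, so normality separates them by open sets [D1] and [D2]. Then [K] is the
    union of two closed pieces: [K] minus [D2], inside [V], and [K] minus [D1], inside [U n]. *)
Let lam_cover (U : (set Z)^nat) n K : (forall i, open (U i)) -> closed K ->
  K `<=` \bigcup_(i < n) U i -> ((lam K)%:E <= \sum_(i < n) rho (U i))%E.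
Proof.
move=> oU; elim: n K => [|n IH] K cK KU.
  rewrite big_ord0 (_ : K = set0) ?lam0//; apply/seteqP; split => // x.
  by move=> /KU[].
set V := \bigcup_(i < n) U i.
have oV : open V by exact: bigcup_open.
have KVU : forall x, K x -> V x \/ U n x.
  move=> x /KU[i /=]; rewrite ltnS leq_eqVlt => /predU1P[->|]; first by right.
  by move=> ilt Ux; left; exists i.
have [D1 [D2 [oD1 oD2 s1 s2 D12]]] : exists D1 D2, [/\ open D1, open D2,
    K `\` U n `<=` D1, K `\` V `<=` D2 & D1 `&` D2 = set0].
  have /(@normal_openP R) := compact_normal hZ cZ; apply.
  - by apply: closedI => //; exact: open_closedC.
  - by apply: closedI => //; exact: open_closedC.
  - by apply/seteqP; split => // x [[Kx nU] [_ nV]]; case: (KVU _ Kx).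
have c1 : closed (K `\` D2) by apply: closedI => //; exact: open_closedC.
have c2 : closed (K `\` D1) by apply: closedI => //; exact: open_closedC.
have -> : K = (K `\` D2) `|` (K `\` D1).
  apply/seteqP; split=> [x Kx|x [[]|[]]//].
  have [D2x|] := pselect (D2 x); last by left.
  right; split=> // D1x; have : (D1 `&` D2) x by [].
  by rewrite D12.
rewrite big_ord_recr/=.
apply: (@le_trans _ _ ((lam (K `\` D2))%:E + (lam (K `\` D1))%:E)%E).
  by rewrite -EFinD lee_fin lamUle.
apply: leeD.
  apply: IH => // x [Kx nO]; apply: contrapT => nV; apply: nO; exact: s2.
apply: lam_rho => // x [Kx nO]; apply: contrapT => nV; apply: nO; exact: s1.
Qed.

Let rho_bigcup (U : (set Z)^nat) : (forall i, open (U i)) ->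
  (rho (\bigcup_i U i) <= \sum_(i <oo) rho (U i))%E.
Proof.
move=> oU; apply: ge_ereal_sup => _ [K [cK KU] <-].
have := closed_cpt cK; rewrite compact_cover => /(_ nat setT U).
move=> /(_ (fun i _ => oU i) KU)[D _ KD].
have [n Dn] : exists n, forall i, i \in finmap.enum_fset D -> (i < n)%N.
  exists (\max_(i <- finmap.enum_fset D) i).+1 => i iD; rewrite ltnS.
  by rewrite (big_rem i)//= leq_maxl.
apply: (@le_trans _ _ (\sum_(i < n) rho (U i))%E).
  apply: lam_cover => // x /KD[i iD Ux]; exists i => //=; exact: Dn.
rewrite -(big_mkord xpredT (fun i => rho (U i))).
exact: nneseries_lim_ge.
Qed.

Let outer_fin A : outer A \is a fin_num.
Proof.
rewrite ge0_fin_numE//; apply: (@le_lt_trans _ _ 1%E); last exact: ltry.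
apply: (@le_trans _ _ (outer setT)); first exact: le_outer.
rewrite outer_open; last exact: openT.
apply: ge_ereal_sup => _ [K [cK _] <-].
by rewrite lee_fin -lamT le_lam//; exact: closedT.
Qed.

Let outer_subadd : sigma_subadditive outer.
Proof.
move=> F; apply/lee_addgt0Pr => e e0.
have e2 n : 0 < e / (2 ^ n.+1)%:R by rewrite divr_gt0// ltr0n expn_gt0.
have /choice[U UP] : forall n, exists U, [/\ open U, F n `<=` U &
    (rho U <= outer (F n) + (e / (2 ^ n.+1)%:R)%:E)%E].
  move=> n; have : (outer (F n) < outer (F n) + (e / (2 ^ n.+1)%:R)%:E)%E.
    by rewrite lteDl// lte_fin.
  move=> /ereal_inf_lt[_ [U [oU FU] <-] /ltW lt]; by exists U.
apply: (@le_trans _ _ (rho (\bigcup_n U n))).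
  rewrite -outer_open; last by apply: bigcup_open => i _; case: (UP i).
  by apply: le_outer; apply: subset_bigcup => i _; case: (UP i).
apply: (le_trans (rho_bigcup _)); first by move=> i; case: (UP i).
apply: (le_trans _ (epsilon_trick _ _ _)) => //; last exact: ltW.
by apply: lee_nneseries => // n _; case: (UP n).
Qed.

HB.instance Definition _ :=
  isOuterMeasure.Build R Z outer outer0 outer_ge0 le_outer outer_subadd.

(** The test set may be enlarged to an open [V]. For closed [K] in the intersection of [V] and [U],
    and closed [L] in [V] minus [K], superadditivity on disjoint closed sets bounds [lam K + lam L]
    by [rho V]. The supremum over [L], then over [K], gives the splitting of [V]. *)
Let caratheodory_open U : open U -> outer.-caratheodory U.
Proof.
move=> oU; apply: le_caratheodory_measurable => A.
apply: le_ereal_inf_tmp => _ [V [oV AV] <-].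
apply: (@le_trans _ _ (outer (V `&` U) + outer (V `&` ~` U))%E).
  by apply: leeD; apply: le_outer; exact: setSI.
rewrite -outer_open// [outer (V `&` U)]outer_open; last exact: openI.
rewrite -leeBrDr; last exact: outer_fin.
apply: ge_ereal_sup => _ [K [cK KVU] <-].
rewrite leeBrDr; last exact: outer_fin.
rewrite addeC -leeBrDr//.
have oVK : open (V `&` ~` K) by apply: openI => //; exact: closed_openC.
apply: (@le_trans _ _ (rho (V `&` ~` K))).
  rewrite -outer_open//; apply: le_outer => x [Vx nUx]; split=> //.
  by move=> /KVU[].
apply: ge_ereal_sup => _ [L [cL LVK] <-].
rewrite leeBrDr// -EFinD addrC; apply: (@le_trans _ _ (lam (K `|` L))%:E).
  rewrite lee_fin lamU//; apply/seteqP; split => // x [Kx /LVK[_]]; exact.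
rewrite outer_open//; apply: lam_rho; first exact: closedU.
by move=> x [/KVU[]//|/LVK[]].
Qed.

Let borel_caratheodory (B : set (borel Z)) :
  measurable B -> outer.-caratheodory B.
Proof.
apply: smallest_sub => [|U oU]; last exact: caratheodory_open.
exact: (@sigma_algebra_measurable _ (caratheodory_type outer)).
Qed.

Let m : set (borel Z) -> \bar R := outer.

Let m_sigma_additive : semi_sigma_additive m.
Proof.
move=> F mF tF mUF; apply: caratheodory_measure_sigma_additive => //.
- by move=> i; exact: borel_caratheodory.
- exact: borel_caratheodory.
Qed.

HB.instance Definition _ :=
  isMeasure.Build _ _ _ m outer0 outer_ge0 m_sigma_additive.

Let mT : m setT = 1%E.
Proof.
rewrite /m outer_open; last exact: openT.
apply/eqP; rewrite eq_le; apply/andP; split.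
  apply: ge_ereal_sup => _ [K [cK _] <-].
  by rewrite lee_fin -lamT le_lam//; exact: closedT.
by rewrite -lamT; apply: lam_rho => //; exact: closedT.
Qed.

HB.instance Definition _ := Measure_isProbability.Build _ _ _ m mT.

Let m_outer (A : set Z) : m A = ereal_inf [set m U | U in [set U | open U /\ A `<=` U]].
Proof.
by congr (ereal_inf _); apply: eq_imagel => U [oU _]; rewrite /m outer_open.
Qed.

Let m_regular : regular_measure m.
Proof.
move=> B mB; split; first exact: m_outer.
apply/eqP; rewrite eq_le; apply/andP; split; last first.
  by apply: ge_ereal_sup => _ [K [_ KB] <-]; exact: le_outer.
apply/lee_addgt0Pr => e e0.
(* Inner regularity at [B] is outer regularity at its complement: an open set slightly larger than
   the complement of [B] has a compact complement inside [B]. *)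
have : (m (~` B) < m (~` B) + e%:E)%E by rewrite lteDl ?lte_fin//; exact: outer_fin.
rewrite [ltLHS]m_outer => /ereal_inf_lt[_ [U [oU BU] <-] lt].
have cU : closed (~` U) by exact: open_closedC.
apply: (@le_trans _ _ (m (~` U) + e%:E)%E); last first.
  apply: leeD => //; apply: ereal_sup_ubound; exists (~` U) => //.
  split; first exact: closed_cpt.
  by move=> x nUx; apply: contrapT => /BU.
have mU : measurable (U : set (borel Z)) by exact: open_borel.
have mR (A : set (borel Z)) : measurable A ->
    exists2 a : R, m A = a%:E & m (~` A) = (1 - a)%:E.
  move=> mA; exists (fine (m A)); first by rewrite fineK//; exact: outer_fin.
  transitivity (1 - m A)%E; first exact: probability_setC.
  by rewrite EFinB fineK//; exact: outer_fin.
have [b -> bC] := mR _ mB; have [u uE uC] := mR _ mU.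
by move: lt; rewrite bC uE uC -!EFinD lte_fin lee_fin; lra.
Qed.

(** The two clauses together make [mass mu U] the supremum of [lam K] over the closed subsets [K] of
    an open [U]; later constructions of measures rest on this. *)
Lemma content_extension : exists mu : regular_probability R Z,
  (forall U K, open U -> closed K -> K `<=` U -> lam K <= mass mu U) /\
  (forall U (a : R), open U -> a < mass mu U ->
     exists K, [/\ closed K, K `<=` U & a < lam K]).
Proof.
exists (RegularProbability m_regular m_outer); split=> [U K oU cK KU|U a oU].
  by rewrite -lee_fin massE /= /m outer_open//; exact: lam_rho.
rewrite -lte_fin massE /= /m outer_open// => /ereal_sup_gt[_ [K [cK KU] <-] lt].
by exists K; split=> //; rewrite -lte_fin.
Qed.

End content.

(** * The weak-* topology through masses of open sets *)

Section weak_star.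
Variables (R : realType) (Z : ptopologicalType).
Hypotheses (cZ : compact [set: Z]) (hZ : hausdorff_space Z).
Implicit Types (mu nu : regular_probability R Z) (U K : set Z).

Lemma integrable_continuous mu (g : Z -> R) : continuous g ->
  mu.-integrable [set: borel Z] (EFin \o g).
Proof.
move=> cg; apply: measurable_bounded_integrable => //.
- by have lt : (mu setT < +oo)%E by rewrite probability_setT ltry.
- apply: (measurability _ (measurable_realfun.RGenOpens.measurableE R)).
  move=> _ [_ [a [b ->]] <-].
  rewrite setTI; apply: open_borel.
  by move/continuousP : cg; apply; exact: interval_open.
- have : compact (range g).
    by apply: continuous_compact cZ; exact: continuous_subspaceT.
  move=> /(@compact_bounded R R^o) [M [Mr Mb]].
  by exists M; split=> // x /Mb b z _; apply: b; exists z.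
Qed.

Lemma functional_ofE mu (g : continuousType Z R) :
  functional_of mu g = \int[mu]_(x in [set: borel Z]) g x.
Proof. by []. Qed.

(** Inner regularity gives a compact [K] in [U] still of mass above [a], and Urysohn's lemma a
    continuous [g] between the indicators of [K] and [U]. Measures whose integral of [g] exceeds [a]
    form a weak-* open neighbourhood of [mu] inside the set. *)
Lemma open_mass_gt U (a : R) : open U ->
  open [set mu : regular_probability R Z | a < mass mu U].
Proof.
move=> oU; rewrite openE => mu /= aU.
have [K [cK KU aK]] := mass_inner (open_borel oU) aU.
have clK : closed K by exact: compact_closed.
have [g [cg g01 g0 g1]] : exists g : Z -> R, [/\ continuous g,
    range g `<=` `[0, 1], g @` (~` U) `<=` [set 0] & g @` K `<=` [set 1]].
  apply/uniform_separatorP.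
  have /(@normal_separatorP R) := compact_normal hZ cZ; apply => //.
  - exact: open_closedC.
  - by apply/seteqP; split => // x [nUx /KU].
have {}g01 x : 0 <= g x <= 1 by have := g01 _ (imageT g x); rewrite /= in_itv.
have {}g0 x : ~ U x -> g x = 0 by move=> nUx; apply: g0; exists x.
have {}g1 x : K x -> g x = 1 by move=> Kx; apply: g1; exists x.
have mU := open_borel oU; have mK := closed_borel clK.
have ig (nu : regular_probability R Z) := integrable_continuous nu cg.
pose phi : continuousType Z R := mkcts cg.
have up (nu : regular_probability R Z) : functional_of nu phi <= mass nu U.
  rewrite functional_ofE /mass -[U in leRHS]setIT -integral_indic//.
  apply: le_Rintegral => //; [exact: ig|exact: integrable_indic|].
  move=> x _; rewrite indicE; case: (boolP (x \in U)) => [_|/negP].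
    by have /andP[] := g01 x.
  by rewrite inE => nUx; rewrite -[leLHS]/(g x) g0.
have low : mass mu K <= functional_of mu phi.
  rewrite functional_ofE /mass -[K in leLHS]setIT -integral_indic//.
  apply: le_Rintegral => //; [exact: integrable_indic|exact: ig|].
  move=> x _; rewrite indicE; case: (boolP (x \in K)) => [|_].
    by rewrite inE => Kx; rewrite -[leRHS]/(g x) g1.
  by have /andP[] := g01 x.
have : open [set nu : regular_probability R Z | a < functional_of nu phi].
  exists (proj phi @^-1` [set r : R | a < r]) => //.
  apply: open_comp => [g' _|]; last exact: open_gt.
  exact: (@proj_continuous (continuousType Z R) (fun=> R) phi).
move=> oA; rewrite /interior nbhsE; exists [set nu | a < functional_of nu phi].
  by split=> //=; exact: lt_le_trans low.
by move=> nu /= /lt_le_trans; apply.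
Qed.

(** The sum is [h] times the number of multiples of [h], among the first [n], lying below [t]. With
    [step_upper] this is a discrete layer-cake formula, exact up to [h]. *)
Let step_lower (n : nat) (h t : R) : 0 <= h -> 0 <= t ->
  \sum_(k < n) h * (k.+1%:R * h < t)%R%:R <= t.
Proof.
move=> h0 t0; elim: n => [|n IH]; first by rewrite big_ord0.
case: (boolP (n.+1%:R * h < t)) => [lt|]; last first.
  by rewrite big_ord_recr/= => /negbTE ->; rewrite mulr0 addr0.
apply: le_trans (ltW lt); apply: (@le_trans _ _ (\sum_(k < n.+1) h)).
  by apply: ler_sum => k _; rewrite ler_piMr//; case: (_ < _).
by rewrite sumr_const card_ord mulr_natl.
Qed.

Let step_upper (n : nat) (h t : R) : 0 <= h -> t <= n.+1%:R * h ->
  t <= h + \sum_(k < n) h * (k.+1%:R * h < t)%R%:R.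
Proof.
move=> h0; elim: n => [|n IH]; first by rewrite big_ord0 mul1r addr0.
case: (boolP (n.+1%:R * h < t)) => [lt le|]; last first.
  rewrite -leNgt => le _; apply: le_trans (IH le) _.
  by rewrite big_ord_recr/= addrA lerDl mulr_ge0.
apply: (le_trans le); rewrite -[n.+2]add1n natrD mulrDl mul1r lerD2l.
apply: (@le_trans _ _ (\sum_(k < n.+1) h)).
  by rewrite sumr_const card_ord mulr_natl.
apply: ler_sum => k _; rewrite (le_lt_trans _ lt) ?mulr1//.
by rewrite ler_wpM2r// ler_nat.
Qed.

Let integral_step mu (c h : R) (n : nat) (U : nat -> set Z) :
  (forall k, open (U k)) ->
  let s := fun x => c + \sum_(k < n) h * \1_(U k) x in
  mu.-integrable [set: borel Z] (EFin \o s) /\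
  \int[mu]_(x in [set: borel Z]) s x = c + h * \sum_(k < n) mass mu (U k).
Proof.
move=> oU /=; elim: n => [|n [IH1 IH2]].
  split.
    under [EFin \o _]eq_fun do rewrite big_ord0 addr0.
    exact: finite_measure_integrable_cst.
  under eq_Rintegral do rewrite big_ord0 addr0.
  by rewrite Rintegral_cst// -[fine _]/(mass mu setT) massT mulr1 big_ord0 mulr0 addr0.
have mU := open_borel (oU n).
have i1 : mu.-integrable [set: borel Z] (EFin \o (fun x => h * \1_(U n) x)).
  have : mu.-integrable [set: borel Z] (fun x => h%:E * (\1_(U n) x)%:E)%E.
    by apply: integrableZl => //; exact: integrable_indic.
  by [].
split.
  have := integrableD (@measurableT _ (borel Z)) IH1 i1.
  congr (_.-integrable _ _); apply/funext => x /=.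
  by rewrite big_ord_recr/= addrA EFinD.
under eq_Rintegral do rewrite big_ord_recr/= addrA.
rewrite RintegralD// IH2 big_ord_recr/= mulrDr addrA; congr (_ + _).
rewrite RintegralZl//; last exact: integrable_indic.
by rewrite /Rintegral integral_indic// setIT.
Qed.

(** The layer-cake sum approximates the integral of [g] by masses of the open superlevel sets of
    [g], so lower bounds on masses of open sets bound integrals from below. The same bound for the
    opposite function controls them from above. *)
Lemma cvg_mass (F : set_system (regular_probability R Z)) mu : Filter F ->
  (forall U (a : R), open U -> a < mass mu U -> F [set nu | a < mass nu U]) ->
  F --> mu.
Proof.
move=> FF Fm.
have lower (g : Z -> R) (e : R) : continuous g -> 0 < e ->
    F [set nu : regular_probability R Z |
       \int[mu]_(x in [set: borel Z]) g x - e <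
       \int[nu]_(x in [set: borel Z]) g x].
  move=> cg e0.
  have [M Mg] : exists M : R, forall x, `|g x| <= M.
    have : compact (range g).
      by apply: continuous_compact cZ; exact: continuous_subspaceT.
    move=> /(@compact_bounded R R^o) [M [Mr Mb]].
    by exists (M + 1) => x; apply: (Mb (M + 1)); [rewrite ltrDl|exists x].
  (* Two errors of size [h] occur: the width of a layer, and [h] times the total loss of [n] masses,
     each within the inverse of [n.+1]. The sum [2 * h] is below [e]. The shift by [M] puts [g] in
     [[0, 2 * M]], which the layers cover. *)
  pose h := e / 4; have h0 : 0 < h by rewrite divr_gt0.
  pose n := Num.trunc (2 * M / h).
  have nM : 2 * M <= n.+1%:R * h.
    by rewrite -ler_pdivrMr//; exact/ltW/truncnS_gt.
  pose U k := [set x | k.+1%:R * h < g x + M].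
  have oU k : open (U k).
    apply: (@open_comp _ _ (fun x => g x + M) [set r | k.+1%:R * h < r]).
      by move=> x _; apply: cvgD; [exact: cg|exact: cvg_cst].
    exact: open_gt.
  pose s x := - M + \sum_(k < n) h * \1_(U k) x.
  have indU k x : \1_(U k) x = (k.+1%:R * h < g x + M)%R%:R :> R.
    by rewrite indicE; congr ((nat_of_bool _)%:R); apply/idP/idP; rewrite inE.
  have sE x : s x = - M + \sum_(k < n) h * (k.+1%:R * h < g x + M)%R%:R.
    by congr (_ + _); apply: eq_bigr => k _; rewrite indU.
  have sg x : s x <= g x.
    rewrite sE addrC lerBlDr; apply: step_lower; first exact: ltW.
    by have := Mg x; rewrite ler_norml => /andP[]; lra.
  have gs x : g x <= h + s x.
    rewrite sE addrCA addrC lerBrDr; apply: step_upper; first exact: ltW.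
    apply: le_trans nM; have := Mg x; rewrite ler_norml => /andP[]; lra.
  have near_n : F [set nu : regular_probability R Z |
      forall k : 'I_n, mass mu (U k) - n.+1%:R^-1 < mass nu (U k)].
    apply: filter_forall => k; apply: Fm => //.
    by rewrite ltrBlDr ltrDl invr_gt0.
  apply: filterS near_n => nu nuU.
  have [smi smE] := integral_step mu (- M) h n oU.
  have [sni snE] := integral_step nu (- M) h n oU.
  have up : \int[mu]_(x in [set: borel Z]) g x <=
      h + (- M + h * \sum_(k < n) mass mu (U k)).
    have ic : mu.-integrable [set: borel Z] (EFin \o cst h).
      exact: finite_measure_integrable_cst.
    apply: (@le_trans _ _ (\int[mu]_(x in [set: borel Z]) (cst h x + s x))).
      apply: le_Rintegral => //; first exact: integrable_continuous.
      by have := integrableD (@measurableT _ (borel Z)) ic smi.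
    by rewrite RintegralD// smE Rintegral_cst// -[fine _]/(mass mu setT) massT mulr1.
  have low : - M + h * \sum_(k < n) mass nu (U k) <= \int[nu]_(x in [set: borel Z]) g x.
    rewrite -snE; apply: (le_Rintegral _ sni (integrable_continuous nu cg)) => //.
    by move=> x _; exact: sg.
  have sum_le : \sum_(k < n) mass mu (U k) <= \sum_(k < n) mass nu (U k) + 1.
    apply: (@le_trans _ _ (\sum_(k < n) (mass nu (U k) + n.+1%:R^-1))).
      by apply: ler_sum => k _; rewrite -lerBlDr ltW//; exact: nuU.
    rewrite big_split/= lerD2l sumr_const card_ord -[X in X <= _]mulr_natl.
    by rewrite ler_pdivrMr// mul1r ler_nat.
  have : h * \sum_(k < n) mass mu (U k) <= h * (\sum_(k < n) mass nu (U k) + 1).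
    by rewrite ler_wpM2l// ltW.
  rewrite mulrDr mulr1.
  have : e = 4 * h by rewrite /h; lra.
  rewrite /=; move: up low h0.
  by move: (\int[mu]_(x in _) _) (\int[nu]_(x in _) _) (h * _) (h * _) => I J A B; lra.
(* Convergence in the initial topology is convergence of the images in the product of lines, hence
   of each coordinate [phi] separately. *)
have cvgF : (@functional_of R Z) @ F --> @functional_of R Z mu.
  apply/cvg_sup => phi; apply/cvg_image.
    by apply/seteqP; split=> // r _; exists (fun=> r).
  suff cvg_phi : (fun nu => functional_of nu phi) @ F --> functional_of mu phi.
    move=> W /cvg_phi FW; exists (proj phi @^-1` W) => //.
    by apply/seteqP; split=> [_ [g Wg <-]//|r Wr]; exists (fun=> r).
  apply/cvgrPdist_lt => e e0.
  have cphi : continuous (phi : Z -> R) by exact: cts_fun.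
  have cN : continuous (fun x => -1 * (phi : Z -> R) x).
    by move=> x; apply: cvgM; [exact: cvg_cst|exact: cphi].
  have intN nu : \int[nu]_(x in [set: borel Z]) (-1 * (phi : Z -> R) x) =
      - functional_of nu phi.
    rewrite RintegralZl//; last exact: integrable_continuous.
    by rewrite functional_ofE mulN1r.
  have := lower _ _ cN e0; rewrite intN.
  have := lower _ _ cphi e0; apply: filterS2 => nu lt1.
  rewrite [X in X -> _]/= intN => lt2; rewrite ltr_norml.
  have {}lt1 : functional_of mu phi - e < functional_of nu phi := lt1.
  move: (functional_of mu phi) (functional_of nu phi) lt1 lt2 => I J lt1 lt2.
  by apply/andP; split; lra.
move=> W [_ [[A oA <-] Amu AW]].
by apply: filterS AW _; apply: cvgF; exact: open_nbhs_nbhs.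
Qed.

(** The filter generated by the finite boxes around [mu] converges to [mu] by [cvg_mass], so each
    neighbourhood contains a box. *)
Lemma nbhs_massP mu (W : set (regular_probability R Z)) : nbhs mu W ->
  exists (n : nat) (U : 'I_n -> set Z) (a : 'I_n -> R),
    [/\ forall i, open (U i), forall i, a i < mass mu (U i) &
        [set nu | forall i, a i < mass nu (U i)] `<=` W].
Proof.
pose box (s : seq (set Z * R)) :=
  [set nu : regular_probability R Z | forall p, p \in s -> p.2 < mass nu p.1].
pose D := [set s : seq (set Z * R) |
  forall p, p \in s -> open p.1 /\ p.2 < mass mu p.1].
have FF : Filter (filter_from D box).
  apply: filter_from_filter; first by exists [::].
  move=> s t Ds Dt; exists (s ++ t).
    by move=> p; rewrite mem_cat => /orP[/Ds|/Dt].
  by move=> nu Dst; split=> p ps; apply: Dst; rewrite mem_cat ps ?orbT.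
have : filter_from D box --> mu.
  apply: cvg_mass => U a oU aU; exists [:: (U, a)].
    by move=> p; rewrite inE => /eqP ->.
  by move=> nu /(_ (U, a)); rewrite inE eqxx; exact.
move=> + muW => /(_ W muW) [s Ds sW].
pose p i := tnth (in_tuple s) i.
have ps i : p i \in s by exact: mem_tnth.
exists (size s), (fun i => (p i).1), (fun i => (p i).2); split.
- by move=> i; have [] := Ds _ (ps i).
- by move=> i; have [] := Ds _ (ps i).
- move=> nu nus; apply: sW => q /(tnthP (in_tuple s)) [i ->]; exact: nus.
Qed.

End weak_star.

(** * Compactness of the space of measures, and density of atomic measures *)

Section space_of_measures.
Variables (R : realType) (Z : ptopologicalType).
Hypotheses (cZ : compact [set: Z]) (hZ : hausdorff_space Z).
Implicit Types (mu nu : regular_probability R Z) (U K : set Z).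

(** Distinct measures differ on some open [U]. A compact [K] in [U] and the complement of [U] have
    disjoint open neighbourhoods [V] and [W], and no probability measure has mass above [a] on [V]
    and above [1 - a] on [W]. *)
Lemma weak_star_hausdorff : hausdorff_space (regular_probability R Z).
Proof.
suff sep mu nu : mu <> nu -> exists A B : set (regular_probability R Z),
    [/\ A mu, B nu, open A, open B & A `&` B = set0].
  rewrite open_hausdorff => mu nu /eqP /sep[A [B [Amu Bnu oA oB AB]]].
  by exists (A, B); rewrite !inE; split=> //; exact/eqP.
move=> munu; have [U oU ltU] : exists2 U, open U & mass nu U < mass mu U.
  apply: contrapT => nU; apply: munu; apply: le_mass_open_eq => U oU.
  by rewrite leNgt; apply/negP => lt; apply: nU; exists U.
pose a := (mass nu U + mass mu U) / 2.
have [K [cK KU aK]] : exists K, [/\ compact K, K `<=` U & a < mass mu K].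
  by apply: mass_inner; [exact: open_borel|rewrite /a; lra].
have clK : closed K by exact: compact_closed.
have [V [W [oV oW KV UW VW]]] : exists V W, [/\ open V, open W,
    K `<=` V, ~` U `<=` W & V `&` W = set0].
  have /(@normal_openP R) := compact_normal hZ cZ; apply => //.
  - exact: open_closedC.
  - by apply/seteqP; split => // x [Kx]; apply; exact: KU.
exists [set rho | a < mass rho V], [set rho | 1 - a < mass rho W]; split.
- exact: lt_le_trans aK (le_mass _ KV).
- rewrite /=; apply: lt_le_trans (le_mass nu UW).
  by rewrite massC; [rewrite /a; lra|exact: open_borel].
- exact: open_mass_gt.
- exact: open_mass_gt.
- apply/seteqP; split => // rho [/= r1 r2].
  have := mass_le1 rho (V `|` W).
  by rewrite massU//; [lra|exact: open_borel|exact: open_borel].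
Qed.

Let ultra_cvg (F : set_system (regular_probability R Z)) (A : set Z) :
  UltraFilter F -> exists r : R, (fun mu => mass mu A) @ F --> r.
Proof.
move=> FU; have FA : fmap (fun mu => mass mu A) F (`[0, 1]%classic : set R).
  by apply: (@filterE _ F) => mu; rewrite /preimage /= in_itv /= mass_ge0 mass_le1.
have [r [_ clr]] := @segment_compact R 0 1 (fmap (fun mu => mass mu A) F) _ FA.
exists r => W rW; have [//|FW] := in_ultra_setVsetC ((fun mu => mass mu A) @^-1` W) FU.
by have [x [nWx Wx]] := clr (~` W) W FW rW; case: (nWx Wx).
Qed.

Lemma weak_star_compact : compact [set: regular_probability R Z].
Proof.
rewrite compact_ultra => F FU _.
have [lam lamP] := choice (fun A => ultra_cvg A FU).
have lamle A B : (forall mu, mass mu A <= mass mu B) -> lam A <= lam B.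
  by move=> AB; apply: ler_cvg_to (lamP A) (lamP B) _; exact: filterE.
have lamD A B : (fun mu => mass mu A + mass mu B) @ F --> lam A + lam B.
  by apply: cvgD; exact: lamP.
have lamT : lam setT = 1.
  have := lamP setT; rewrite (_ : (fun mu => _) = cst 1); last first.
    by apply/funext => mu; exact: massT.
  by move/cvg_unique; apply=> //; exact: cvg_cst.
have [||||//|mu [muP1 muP2]] := content_extension cZ hZ (lam := lam).
- move=> A; apply: (ler_cvg_to (cvg_cst 0) (lamP A)).
  by apply: filterE => mu; exact: mass_ge0.
- by move=> A B _ _ AB; apply: lamle => mu; exact: le_mass.
- move=> A B cA cB; apply: (ler_cvg_to (lamP (A `|` B)) (lamD A B)).
  by apply: filterE => mu; apply: massU2; exact: closed_borel.
- move=> A B cA cB AB; apply: (ler_cvg_to (lamD A B) (lamP (A `|` B))).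
  by apply: filterE => mu; rewrite massU//; exact: closed_borel.
exists mu; split=> //; apply: cvg_mass => // U a oU /(muP2 _ _ oU)[K [cK KU aK]].
(* [lam K] is the limit of [mass nu K] along [F], so the strict bound at the limit holds eventually
   and passes from [K] to [U]. *)
have FK : F [set nu | a < mass nu K] by exact: cvgr_gt (lamP K) _ aK.
by apply: filterS FK => nu aKnu; exact: lt_le_trans aKnu (le_mass _ KU).
Qed.

Lemma mixture_ex (I : finType) (b : I -> R) (k : I -> regular_probability R Z) :
  (forall i, 0 <= b i) -> \sum_i b i = 1 ->
  exists mu, forall U, open U -> mass mu U = \sum_i b i * mass (k i) U.
Proof.
move=> b0 b1; pose lam (A : set Z) := \sum_i b i * mass (k i) A.
have le_lam A B : A `<=` B -> lam A <= lam B.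
  by move=> AB; apply: ler_sum => i _; rewrite ler_wpM2l// le_mass.
have lamT : lam setT = 1.
  by rewrite -b1; apply: eq_bigr => i _; rewrite massT mulr1.
have [||||//|mu [muP1 muP2]] := content_extension cZ hZ (lam := lam).
- by move=> A; apply: sumr_ge0 => i _; rewrite mulr_ge0// mass_ge0.
- by move=> A B _ _; exact: le_lam.
- move=> A B cA cB; rewrite /lam -big_split/=; apply: ler_sum => i _.
  by rewrite -mulrDr ler_wpM2l//; apply: massU2; exact: closed_borel.
- move=> A B cA cB AB; rewrite /lam -big_split/=; apply: ler_sum => i _.
  by rewrite -mulrDr ler_wpM2l// massU//; exact: closed_borel.
exists mu => U oU; apply/eqP; rewrite eq_le; apply/andP; split.
  rewrite leNgt; apply/negP => /(muP2 _ _ oU)[K [cK KU]].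
  by move/lt_le_trans => /(_ _ (le_lam _ _ KU)); rewrite ltxx.
apply/ler_addgt0Pr => e e0.
have /choice[K KP] : forall i, exists K, [/\ compact K, K `<=` U &
    mass (k i) U - e < mass (k i) K].
  by move=> i; apply: mass_inner; [exact: open_borel|lra].
(* One closed set that nearly exhausts [U] for all the measures [k i] at once. *)
pose L := \bigcup_(i in [set: I]) K i.
have cL : closed L.
  apply: (@closed_bigcup _ I [set: I] K) => [|i _]; first exact: finite_finset.
  by apply: compact_closed => //; case: (KP i).
have LU : L `<=` U by move=> x [i _ Kx]; have [_ + _] := KP i; exact.
rewrite -lerBlDr; apply: le_trans (muP1 _ _ oU cL LU).
rewrite lerBlDr -[e]mul1r -b1 mulr_suml -big_split/=; apply: ler_sum => i _.
rewrite -mulrDr ler_wpM2l// -lerBlDr; have [_ _ /ltW KL] := KP i.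
by apply: le_trans KL _; apply: le_mass => x Kx; exists i.
Qed.

Lemma dirac_ex (z : Z) : exists mu : regular_probability R Z,
  forall U, open U -> mass mu U = \1_U z.
Proof.
have ind1 (A : set Z) : A z -> \1_A z = 1 :> R.
  by move=> Az; rewrite indicE mem_set.
have ind (A : set Z) :
    (A z /\ \1_A z = 1 :> R) \/ (~ A z /\ \1_A z = 0 :> R).
  by rewrite indicE; have [Az|Az] := pselect (A z); [left|right];
    rewrite ?(mem_set Az) ?(memNset Az).
have ind_le (A B : set Z) : (A z -> B z) -> \1_A z <= \1_B z :> R.
  case: (ind A) => -[HA ->] AB; last by case: (ind B) => -[_ ->].
  by rewrite ind1//; exact: AB.
have [||||//|mu [muP1 muP2]] :=
    content_extension cZ hZ (lam := fun A : set Z => \1_A z : R).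
- by move=> A; rewrite indicE.
- by move=> A B _ _ AB; rewrite ind_le; [|move/AB].
- move=> A B _ _; case: (ind (A `|` B)) => -[H ->].
    by case: H => /ind1 ->; rewrite ?lerDl ?lerDr indicE.
  by rewrite addr_ge0.
- move=> A B _ _ AB; case: (ind A) => -[HA ->].
    rewrite [\1_B z]indicE memNset; last first.
      by move=> HB; have : (A `&` B) z by []; rewrite AB.
    by rewrite addr0 indicE mem_set//; left.
  by rewrite add0r ind_le//; right.
- by rewrite indicT.
exists mu => U oU; case: (ind U) => -[HU E]; rewrite E.
  apply/eqP; rewrite eq_le mass_le1/=.
  have clz : closed [set z].
    exact: accessible_closed_set1 (hausdorff_accessible hZ) z.
  have := muP1 U [set z] oU clz; rewrite indicE mem_set//; apply.
  by move=> _ ->.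
apply/eqP; rewrite eq_le mass_ge0 andbT leNgt; apply/negP.
move=> /(muP2 _ _ oU)[K [_ KU]].
by rewrite indicE memNset ?ltxx// => /KU.
Qed.

Lemma atomic_ex (I : finType) (b : I -> R) (z : I -> Z) :
  (forall i, 0 <= b i) -> \sum_i b i = 1 ->
  exists mu : regular_probability R Z,
    forall U, open U -> mass mu U = \sum_i b i * \1_U (z i).
Proof.
move=> b0 b1; have /choice[k kP] := fun i => dirac_ex (z i).
have [mu muP] := mixture_ex k b0 b1; exists mu => U oU.
by rewrite muP//; apply: eq_bigr => i _; rewrite kP.
Qed.

Lemma mass_partition mu (T : finType) (g : Z -> T) (B : set Z) :
  measurable (B : set (borel Z)) ->
  (forall t, measurable (g @^-1` [set t] : set (borel Z))) ->
  mass mu B = \sum_t mass mu (B `&` g @^-1` [set t]).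
Proof.
move=> mB mg.
suff E s : uniq s -> measurable (B `&` g @^-1` [set` s] : set (borel Z)) /\
    mass mu (B `&` g @^-1` [set` s]) =
    \sum_(t <- s) mass mu (B `&` g @^-1` [set t]).
  rewrite -big_enum/= -(E _ (enum_uniq T)).2; congr (mass mu _).
  by apply/seteqP; split=> [x Bx|x []//]; split=> //=; rewrite mem_enum.
elim: s => [_|t s IH /=/andP[ts /IH[ms Es]]].
  have -> : B `&` g @^-1` [set` [::]] = set0 by apply/seteqP; split=> // x [].
  by rewrite mass0 big_nil.
have -> : B `&` g @^-1` [set` t :: s] =
    (B `&` g @^-1` [set t]) `|` (B `&` g @^-1` [set` s]).
  apply/seteqP; split=> [x [Bx /=]|x [[Bx /= ->]|[Bx /= gs]]].
  - by rewrite inE => /predU1P[->|gs]; [left|right].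
  - by split=> //=; rewrite inE eqxx.
  - by split=> //=; rewrite inE gs orbT.
have mt : measurable (B `&` g @^-1` [set t] : set (borel Z)).
  exact: measurableI.
split; first exact: measurableU.
rewrite massU// ?big_cons ?Es//; apply/seteqP; split=> // x [[_ /= ->] [_ /=]].
by rewrite (negbTE ts).
Qed.

(** The index [t] is the membership pattern of a point in the sets [U j], and [w t] is the mass of
    the points of [E] with that pattern. The last clause keeps only the positive memberships, since
    these are open conditions and survive a small displacement of [x]. *)
Lemma atoms_ex mu (E : set Z) (n : nat) (U : 'I_n -> set Z) :
  measurable (E : set (borel Z)) -> (forall j, open (U j)) ->
  exists w : {ffun 'I_n -> bool} -> R,
  [/\ forall t, 0 <= w t, \sum_t w t = mass mu E,
      forall j, \sum_(t : {ffun 'I_n -> bool} | t j) w t = mass mu (E `&` U j) &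
      forall t, 0 < w t -> exists2 x, E x & forall j, t j -> U j x].
Proof.
move=> mE oU; pose g x := [ffun j => x \in U j] : {ffun 'I_n -> bool}.
have mg (t : {ffun 'I_n -> bool}) : measurable (g @^-1` [set t] : set (borel Z)).
  have -> : g @^-1` [set t] = \bigcap_j (if t j then U j else ~` U j).
    apply/seteqP; split=> [x /= <- j _|x gx /=].
      by rewrite ffunE; case: ifPn; [rewrite inE|move/negP; rewrite inE].
    apply/ffunP => j; rewrite ffunE; have := gx j Logic.I.
    by case: (t j) => H; [exact: mem_set|exact: memNset].
  apply: fin_bigcap_measurable => [|j _]; first exact: finite_finset.
  by case: (t j); [|apply: measurableC]; exact: open_borel.
have gU (t : {ffun 'I_n -> bool}) x j : g x = t -> U j x -> t j.
  by move=> <- Ux; rewrite ffunE mem_set.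
have Ug (t : {ffun 'I_n -> bool}) x j : g x = t -> t j -> U j x.
  by move=> <-; rewrite ffunE inE.
exists (fun t => mass mu (E `&` g @^-1` [set t])); split.
- by move=> t; exact: mass_ge0.
- by rewrite -mass_partition.
- move=> j; have mEU : measurable (E `&` U j : set (borel Z)).
    by apply: measurableI => //; exact: open_borel.
  rewrite (mass_partition mu mEU mg) [RHS](bigID (fun t : {ffun 'I_n -> bool} => t j))/=.
  rewrite [X in _ + X]big1 ?addr0.
    apply: eq_bigr => t tj; congr (mass mu _); apply/seteqP; split=> x.
      by move=> [Ex gx]; split=> //; split=> //; exact: Ug tj.
    by move=> [[Ex _] gx].
  move=> t ntj; rewrite (_ : _ `&` _ = set0) ?mass0//; apply/seteqP.
  by split=> // x [[_ Ux] gx]; move: ntj; rewrite (gU _ _ _ gx Ux).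
- move=> t; have [->|/set0P[x [Ex gx]] _] := eqVneq (E `&` g @^-1` [set t]) set0.
    by rewrite mass0 ltxx.
  by exists x => // j; exact: Ug.
Qed.


(* A regular measure is determined by its values on open sets, so this says
   [mu = \sum_i b i * delta_(z i)]. *)
Definition atomic (D : set Z) mu := exists (I : finType) (b : I -> R) (z : I -> Z),
  [/\ forall i, 0 <= b i, \sum_i b i = 1, forall i, D (z i) &
      forall U, open U -> mass mu U = \sum_i b i * \1_U (z i)].

Lemma atomic_dense (D : set Z) : dense D -> dense (atomic D).
Proof.
move=> dD W [mu Wmu] oW.
have [n [U [a [oU aU sW]]]] := nbhs_massP cZ (open_nbhs_nbhs (conj oW Wmu)).
have [w [w0 w1 wU wP]] := atoms_ex mu (@measurableT _ (borel Z)) oU.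
(* A pattern of weight zero may be realised by no point; any point of [D] then serves. *)
have /choice[z zP] : forall t, exists z, D z /\ (0 < w t -> forall j, t j -> U j z).
  move=> t; have [w_gt0|w_le0] := ltP 0 (w t); last first.
    have [|z [_ Dz]] := dD setT _ openT; first by exists point.
    by exists z; split=> //; lra.
  have [x _ Ux] := wP t w_gt0.
  have [||z [Oz Dz]] := dD [set y | forall j, t j -> U j y]°.
  - exists x; apply: filter_forall => j; case: (boolP (t j)) => [tj|_].
      by apply: filterS (open_nbhs_nbhs (conj (oU j) (Ux j tj))) => y Uy.
    exact: filterE.
  - exact: open_interior.
  by exists z; split=> // _ j tj; exact: (interior_subset Oz).
have [|nu nuP] := atomic_ex z w0; first by rewrite w1 massT.
exists nu; split; last first.
  exists {ffun 'I_n -> bool}, w, z; split=> //; first by rewrite w1 massT.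
  by move=> t; case: (zP t).
apply: sW => j /=; apply: (lt_le_trans (aU j)).
(* A pattern containing [j] contributes its full weight to [U j]; the remaining patterns can only
   add mass. *)
rewrite -[X in mass mu X]setTI -wU nuP//.
rewrite [leRHS](bigID (fun t : {ffun 'I_n -> bool} => t j))/=.
rewrite ler_wpDr//; first by apply: sumr_ge0 => t _; rewrite mulr_ge0.
apply: ler_sum => t tj; have := w0 t; rewrite le_eqVlt => /predU1P[<-|wt].
  by rewrite mul0r.
have [_ /(_ wt j tj) Uz] := zP t.
by rewrite indicE mem_set// mulr1.
Qed.

End space_of_measures.

(** * Openness of the push-forward over measures with finite support *)

Section push.
Variables (R : realType) (X Y : ptopologicalType).
Hypotheses (cX : compact [set: X]) (hX : hausdorff_space X)
  (cY : compact [set: Y]) (hY : hausdorff_space Y).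
Variable f : X -> Y.
Hypotheses (cf : continuous f) (sf : set_surj [set: X] [set: Y] f).

Let fs : regular_probability R X -> regular_probability R Y :=
  pushforward_regular cX hX hY cf.

Lemma mass_push mu (A : set Y) : mass (fs mu) A = mass mu (f @^-1` A).
Proof. by []. Qed.

Let open_preim (V : set Y) : open V -> open (f @^-1` V).
Proof. by move/continuousP : cf; apply. Qed.

Let closed_fiber s : closed (f @^-1` [set s]).
Proof.
apply: closed_comp => [x _|]; first exact: cf.
exact: accessible_closed_set1 (hausdorff_accessible hY) s.
Qed.

Let section y : exists x, f x = y.
Proof. by have [x _ <-] := sf (I : [set: Y] y); exists x. Qed.

Lemma push_continuous : continuous fs.
Proof.
move=> mu; have FF : Filter (fs @ mu) by exact: (fmap_filter fs (nbhs_filter mu)).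
apply: (cvg_mass cY) => V a oV.
rewrite mass_push => aV.
have oA : open [set nu : regular_probability R X | a < mass nu (f @^-1` V)].
  by apply: open_mass_gt => //; exact: open_preim.
exact: open_nbhs_nbhs.
Qed.

Lemma push_closed (C : set (regular_probability R X)) :
  closed C -> closed (fs @` C).
Proof.
move=> cC; apply: compact_closed; first exact: weak_star_hausdorff.
apply: continuous_compact; first by apply: continuous_subspaceT; exact: push_continuous.
by apply: (subclosed_compact cC (weak_star_compact cX hX)).
Qed.

(** The image is closed by compactness, and it contains the dense set of atomic measures, whose
    atoms lift through [f]. *)
Lemma push_surj : set_surj [set: regular_probability R X]
  [set: regular_probability R Y] fs.
Proof.
move=> nu _; have : closed (fs @` setT) by apply: push_closed; exact: closedT.
apply => W; rewrite nbhsE => -[V [oV Vnu] VW].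
have [||nu' [Vnu' [I [b [z [b0 b1 _ nu'P]]]]]] :=
    atomic_dense (R := R) cY hY (D := setT) _ _ oV.
- by move=> A [y Ay] _; exists y.
- by exists nu.
have /choice[x xz] := fun i => section (z i).
have [mu muP] := atomic_ex cX hX x b0 b1.
exists (fs mu); split; first by exists mu.
apply: VW; rewrite (_ : fs mu = nu')//; apply: le_mass_open_eq => U oU.
rewrite mass_push muP; last exact: open_preim.
by rewrite nu'P//; apply: ler_sum => i _; rewrite -(xz i).
Qed.

(** Lower semicontinuity at [s] of the fibre map [y |-> f^-1(y)]. *)
Definition open_at_fiber (s : Y) :=
  forall U x, open U -> U x -> f x = s -> nbhs s (f @` U).

(* Quantitative form of lower semicontinuity at [delta_s]: [mu] restricted to
   the fibre of [s] is approximated from below on the [U j] by measures on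
   nearby fibres; the factor [mass mu (f @^-1` [set s])] replaces a
   normalisation, so that a null fibre needs no special treatment. *)
Lemma fiber_lift mu (n : nat) (U : 'I_n -> set X) (s : Y) :
  (forall j, open (U j)) -> open_at_fiber s ->
  \forall z \near s, exists k : regular_probability R X,
    (forall V, open V -> mass (fs k) V = \1_V z) /\
    forall j, mass mu (f @^-1` [set s] `&` U j) <=
              mass mu (f @^-1` [set s]) * mass k (U j).
Proof.
move=> oU fo; set E := f @^-1` [set s].
have [w [w0 w1 wU wP]] := atoms_ex mu (closed_borel (@closed_fiber s)) oU.
(* There are finitely many patterns, and each one of positive weight is realised by a point of the
   fibre of [s]. Openness at that point moves it into the fibre of any nearby [z] without leaving
   the sets [U j] of the pattern. *)
have : \forall z \near s, forall t, 0 < w t ->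
    exists x, f x = z /\ forall j, t j -> U j x.
  apply: filter_forall => t; have [w_gt0|_] := ltP 0 (w t); last exact: filterE.
  have [x Ex Ux] := wP t w_gt0.
  have On : nbhs x [set y | forall j, t j -> U j y].
    apply: filter_forall => j; case: (boolP (t j)) => [tj|_].
      by apply: filterS (open_nbhs_nbhs (conj (oU j) (Ux j tj))) => y Uy.
    exact: filterE.
  have := fo _ x (open_interior _) On Ex; apply: filterS => z [y Oy <-] _.
  by exists y; split=> //; exact: (interior_subset Oy).
apply: filterS => z zP.
have /choice[x xP] t : exists x, f x = z /\ (0 < w t -> forall j, t j -> U j x).
  have [/zP[x [fx Ux]]|w_le0] := ltP 0 (w t); first by exists x.
  by have [x fx] := section z; exists x.
have [E0|E0] := eqVneq (mass mu E) 0.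
  have [y fy] := section z; have [k kP] := dirac_ex R cX hX y.
  exists k; split=> [V oV|j].
    by rewrite mass_push kP; [rewrite -fy|exact: open_preim].
  by rewrite E0 mul0r -E0 le_mass//; exact: subIsetl.
have Egt : 0 < mass mu E by rewrite lt_def E0 mass_ge0.
have [||k kP] := atomic_ex cX hX (b := fun t => w t / mass mu E) x.
- by move=> t; rewrite divr_ge0// mass_ge0.
- by rewrite -mulr_suml w1 divff.
exists k; split=> [V oV|j].
  rewrite mass_push kP; last exact: open_preim.
  under eq_bigr => t _.
    have -> : \1_(f @^-1` V) (x t) = \1_V z :> R by rewrite -(xP t).1.
    over.
  by rewrite -mulr_suml -mulr_suml w1 divff// mul1r.
rewrite -wU kP// mulr_sumr [leRHS](bigID (fun t : {ffun 'I_n -> bool} => t j))/=.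
rewrite ler_wpDr//.
  by apply: sumr_ge0 => t _; rewrite !mulr_ge0// ?invr_ge0 ?mass_ge0.
apply: ler_sum => t tj; rewrite mulrA (mulrC (mass mu E)) divfK//.
have := w0 t; rewrite le_eqVlt => /predU1P[<-|wt]; first by rewrite mul0r.
by rewrite indicE mem_set ?mulr1//; exact: (xP t).2.
Qed.

Lemma disjoint_nbhs (S : seq Y) (G : Y -> set Y) :
  (forall s, s \in S -> nbhs s (G s)) ->
  exists H : Y -> set Y, (forall s, s \in S -> [/\ open (H s), H s s & H s `<=` G s]) /\
    forall s t, s \in S -> t \in S -> H s `&` H t !=set0 -> s = t.
Proof.
move=> GS.
have /choice[P PP] : forall st : Y * Y, exists AB : set Y * set Y,
    st.1 <> st.2 -> [/\ nbhs st.1 AB.1, nbhs st.2 AB.2 & AB.1 `&` AB.2 = set0].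
  move=> [s t] /=; have [->|st] := eqVneq s t; first by exists (setT, setT).
  have := hY; rewrite open_hausdorff => /(_ _ _ st)[[A B] /=].
  rewrite !inE => -[As Bt] [oA oB AB0].
  exists (A, B) => _ /=.
  by split; [exact: open_nbhs_nbhs|exact: open_nbhs_nbhs|].
(* The chosen separation depends on the order of the pair, so both orders are intersected. *)
pose Q s t := (P (s, t)).1 `&` (P (t, s)).2.
have Qn s t : s != t -> nbhs s (Q s t).
  move=> /eqP st; have [? _ _] := PP (s, t) st.
  have [|_ ? _] := PP (t, s); first by move=> /= ts; exact: st.
  exact: filterI.
pose H s := (G s `&` [set y | forall t : seq_sub S, s != val t -> Q s (val t) y])°.
exists H; split=> [s sS|s t sS tS [y [Hs Ht]]].
  split; first exact: open_interior.
    apply: filterI; first exact: GS.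
    apply: filter_forall => t; have [_|st] := eqVneq s (val t); first exact: filterE.
    by apply: filterS (Qn _ _ st).
  by apply: subset_trans (@interior_subset _ _) _; exact: subIsetl.
apply/eqP; apply: contrapT => /negP st.
have [_ /(_ (SeqSub tS) st) [Py _]] := interior_subset Hs.
have ts : t != s by rewrite eq_sym.
have [_ /(_ (SeqSub sS) ts) [_ Py']] := interior_subset Ht.
have [_ _ P0] := PP (s, t) (elimN eqP st).
by have : ((P (s, t)).1 `&` (P (s, t)).2) y by []; rewrite P0.
Qed.

(** The preimage of the complement of [S] is null, so [mu] lives on the finitely many fibres over
    [S]. *)
Lemma mass_fibers mu (S : seq Y) (U : set X) : open U ->
  mass (fs mu) (~` [set` S]) = 0 ->
  mass mu U <= \sum_(s <- S) mass mu (f @^-1` [set s] `&` U).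
Proof.
move=> oU S0; have mf s : measurable (f @^-1` [set s] `&` U : set (borel X)).
  apply: measurableI; last exact: open_borel.
  by apply: closed_borel; exact: (@closed_fiber s).
have mS (T : seq Y) : measurable (f @^-1` [set` T] `&` U : set (borel X)) /\
    mass mu (f @^-1` [set` T] `&` U) <=
    \sum_(s <- T) mass mu (f @^-1` [set s] `&` U).
  elim: T => [|s T [mT IH]].
    rewrite (_ : _ `&` _ = set0); last by apply/seteqP; split=> // x [].
    by rewrite mass0 big_nil.
  have -> : f @^-1` [set` s :: T] `&` U =
      (f @^-1` [set s] `&` U) `|` (f @^-1` [set` T] `&` U).
    rewrite -setIUl; congr (_ `&` _); apply/seteqP; split=> x /=.
      by rewrite inE => /predU1P.
    by rewrite inE => /predU1P.
  split; first exact: measurableU.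
  by rewrite big_cons; apply: le_trans (massU2 _ (mf s) mT) _; rewrite lerD2l.
have [mST leS] := mS S; apply: le_trans leS.
have oUS : closed [set` S].
  exact: (accessible_finite_set_closed.1 (hausdorff_accessible hY)) (finite_seq S).
have mc : measurable (f @^-1` (~` [set` S]) : set (borel X)).
  by apply: open_borel; apply: open_preim; exact: closed_openC.
rewrite -[leRHS]addr0 -S0 mass_push; apply: le_trans (massU2 _ mST mc).
by apply: le_mass => x Ux; have [Sx|nSx] := pselect ([set` S] (f x)); [left|right].
Qed.

Lemma push_open_at mu (S : seq Y) (W : set (regular_probability R X)) :
  (forall s, s \in S -> open_at_fiber s) ->
  mass (fs mu) (~` [set` S]) = 0 -> nbhs mu W -> nbhs (fs mu) (fs @` W).
Proof.
wlog uS : S / uniq S => [wlogS fo S0|fo S0 muW].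
  apply: (wlogS (undup S)); first exact: undup_uniq.
    by move=> s; rewrite mem_undup; exact: fo.
  rewrite (_ : [set` undup S] = [set` S])//.
  by apply/seteqP; split=> s /=; rewrite mem_undup.
(* Shrinking [W] to a closed neighbourhood [closure B] makes the image closed, so it will suffice to
   lift atomic measures close to a given [nu]. *)
have [B muB BW] := compact_regular (weak_star_hausdorff cX hX)
  (weak_star_compact cX hX) (@filterT _ _ (nbhs_filter mu)) muW.
have [n [U [a [oU aU sB]]]] := nbhs_massP cX muB.
pose E s := f @^-1` [set s].
(* The common slack in the conditions defining the box; the default 1 keeps [d] positive when there
   are none. *)
pose d := \big[Num.min/1]_j (mass mu (U j) - a j).
have d0 : 0 < d by apply: lt_bigmin => // j _; rewrite subr_gt0.
have dle j : d <= mass mu (U j) - a j by exact: bigmin_le_cond.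
(* A loss of [e] at each point of [S] adds up to strictly less than [d]. *)
pose e := d / (size S).+1%:R.
have e0 : 0 < e by rewrite divr_gt0.
have esz : (size S)%:R * e < d.
  by rewrite mulrCA gtr_pMr// ltr_pdivrMr// mul1r ltr_nat.
have [H [HG Hdisj]] := disjoint_nbhs (fun s sS => fiber_lift mu oU (fo s sS)).
pose N := [set nu : regular_probability R Y | forall s : seq_sub S,
  mass mu (E (val s)) - e < mass nu (H (val s))].
have nN : nbhs (fs mu) N.
  apply: (@filter_forall _ _ _ _ (nbhs_filter (fs mu))) => s.
  have [oH Hs _] := HG _ (valP s).
  apply: open_nbhs_nbhs; split; first exact: open_mass_gt.
  rewrite /= mass_push ltrBlDr (@le_lt_trans _ _ (mass mu (f @^-1` H (val s))))//.
    by apply: le_mass => x Ex; rewrite /preimage /= Ex.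
  by rewrite ltrDl.
suff NB : N° `<=` fs @` closure B.
  apply: (@filterS _ _ (nbhs_filter (fs mu)) N°); last exact: nbhs_interior.
  by apply: (subset_trans NB); exact: image_subset.
move=> nu Nnu; apply: (push_closed (@closed_closure _ B)) => V.
rewrite nbhsE => -[V' [oV' V'nu] V'V].
have [||nu' [[V'nu' Nnu'] [I [b [z [b0 b1 _ nu'P]]]]]] :=
    atomic_dense (R := R) cY hY (D := setT) _ _ (openI oV' (@open_interior _ N)).
- by move=> A [y Ay] _; exists y.
- by exists nu.
exists nu'; split; last exact: V'V.
(* The proportion of the fibre of [s] lying in [U j]; it is 0 for a null fibre, by the convention on
   division by zero. *)
pose q s j := mass mu (E s `&` U j) / mass mu (E s).
have /choice[k kP] : forall i, exists k : regular_probability R X,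
    (forall V, open V -> mass (fs k) V = \1_V (z i)) /\
    forall j, \sum_(s <- S) q s j * \1_(H s) (z i) <= mass k (U j).
  (* If [z i] lies in some [H s], disjointness leaves one term in the sum and [fiber_lift] bounds
     it. Otherwise the sum vanishes and any measure over [z i] will do. *)
  move=> i; have [[s [sS Hs]]|nH] := pselect (exists s, s \in S /\ H s (z i)).
    have [_ _ /(_ _ Hs) [k [k1 k2]]] := HG _ sS; exists k; split=> // j.
    rewrite (bigD1_seq s)//= big1_seq ?addr0; last first.
      move=> t /andP[ts tS]; rewrite indicE memNset ?mulr0// => Ht.
      by move: ts; rewrite (Hdisj s t) ?eqxx//; exists (z i).
    rewrite indicE mem_set// mulr1 /q; have [->|E0] := eqVneq (mass mu (E s)) 0.
      by rewrite invr0 mulr0 mass_ge0.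
    by rewrite ler_pdivrMr ?lt_def ?E0 ?mass_ge0// mulrC.
  have [x xz] := section (z i); have [k kP] := dirac_ex R cX hX x.
  exists k; split=> [V0 oV0|j].
    by rewrite mass_push kP; [rewrite -xz|exact: open_preim].
  rewrite big1_seq ?mass_ge0// => s /andP[_ sS].
  by rewrite indicE memNset ?mulr0// => Hs; apply: nH; exists s.
have [mu' mu'P] := mixture_ex cX hX k b0 b1.
exists mu'.
  (* The chain of estimates: [mass mu' (U j)] is at least the sum over [s] of
     [q s j * mass nu' (H s)]. Each term is at least [mass mu (E s] meet [U j)] minus [e], because
     [q s j <= 1], and these masses sum to at least [mass mu (U j)]. *)
  apply: subset_closure; apply: sB => j; rewrite mu'P//.
  apply: (@lt_le_trans _ _ (mass mu (U j) - (size S)%:R * e)).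
    by have := dle j; move: esz; lra.
  apply: (@le_trans _ _ (\sum_(s <- S) q s j * mass nu' (H s))); last first.
    apply: (@le_trans _ _ (\sum_i b i * \sum_(s <- S) q s j * \1_(H s) (z i))).
      under [leRHS]eq_bigr do rewrite mulr_sumr.
      rewrite exchange_big/= !big_seq; apply: ler_sum => s sS.
      rewrite nu'P; last by have [] := HG _ sS.
      by rewrite mulr_sumr; apply: ler_sum => i _; rewrite mulrCA.
    by apply: ler_sum => i _; rewrite ler_wpM2l//; exact: (kP i).2.
  rewrite lerBlDr; apply: le_trans (mass_fibers (oU j) S0) _.
  have -> : (size S)%:R * e = \sum_(s <- S) e.
    by rewrite big_const_seq count_predT iter_addr_0 mulr_natl.
  rewrite -big_split/= !big_seq.
  apply: ler_sum => s sS; have Nb := interior_subset Nnu'.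
  have := Nb (SeqSub sS); rewrite /= => lt.
  have mle : mass mu (E s `&` U j) <= mass mu (E s) by apply: le_mass; exact: subIsetl.
  have := mass_ge0 mu (E s `&` U j); rewrite /q.
  have [E0|E0] := eqVneq (mass mu (E s)) 0.
    by rewrite E0 invr0 mulr0 mul0r add0r => m0; move: mle; rewrite E0; lra.
  have Egt : 0 < mass mu (E s) by rewrite lt_def E0 mass_ge0.
  move: (mass mu (E s `&` U j)) (mass mu (E s)) (mass nu' (H s)) lt mle Egt.
  move=> m w h lt mw w_gt0 m0; have qw : m / w * w = m by rewrite divfK ?gt_eqF.
  have : m / w <= 1 by rewrite ler_pdivrMr ?mul1r.
  have : 0 <= m / w by rewrite divr_ge0// ltW.
  by move: (m / w) qw => r qw r0 r1; nra.
(* Each [k i] lies over [z i], so mixing with the weights [b i] reproduces [nu']. *)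
apply: le_mass_open_eq => V0 oV0; rewrite mass_push mu'P ?nu'P//; last exact: open_preim.
by apply: ler_sum => i _; rewrite -(kP i).1// mass_push.
Qed.

End push.

(** * Vietoris neighbourhoods and continuity of the fibre map *)

Section vietoris_facts.
Variable A : topologicalType.

Lemma vietoris_open (s : seq (set A)) : (0 < size s)%N ->
  (forall U, U \in s -> open U /\ U !=set0) -> open (vietoris s).
Proof.
move=> s0 sP; exists [set vietoris s]; last by rewrite bigcup_set1.
by move=> _ ->; exists s.
Qed.

Lemma nbhs_vietoris (K : hyperspace A) (W : set (hyperspace A)) : nbhs K W ->
  exists s : seq (set A), [/\ forall U, U \in s -> open U, vietoris s K &
    vietoris s `<=` W].
Proof.
rewrite nbhsE => -[_ [[D DB <-] [V DV VK]] DW].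
have [s [_ sP] sV] := DB _ DV; exists s; split.
- by move=> U /sP[].
- by rewrite sV.
- by rewrite sV => L VL; apply: DW; exists V.
Qed.

End vietoris_facts.

Lemma continuous_fiber_open (A B : topologicalType) (g : A -> B)
    (F : B -> hyperspace A) (b : B) (U : set A) :
  (forall b, F b = g @^-1` [set b] :> set A) -> {for b, continuous F} ->
  open U -> (exists2 x, U x & g x = b) -> nbhs b (g @` U).
Proof.
move=> FE cF oU [x Ux gx].
(* This basic open set consists of all closed sets meeting [U]; continuity at [b] makes every nearby
   fibre meet [U]. *)
have : nbhs (F b) (vietoris [:: U; setT]).
  apply: open_nbhs_nbhs; split.
    apply: vietoris_open => // V; rewrite !inE => /orP[]/eqP ->.
      by split; [|exists x].
    by split; [exact: openT|exists x].
  split=> [y _|V]; first by exists setT; rewrite //= !inE eqxx orbT.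
  by rewrite !inE => /orP[]/eqP ->; exists x; split=> //; rewrite FE.
move=> /cF FV; apply: (@filterS _ _ (nbhs_filter b) _ _ _ FV) => c [_ /(_ U)].
by rewrite inE eqxx => /(_ isT) [y []]; rewrite FE => gy Uy; exists y.
Qed.

(** * Dense openness and semi-openness of the push-forward *)

Theorem mainTheorem6 (R : realType) (X Y : ptopologicalType)
    (cX : compact [set: X]) (hX : hausdorff_space X)
    (cY : compact [set: Y]) (hY : hausdorff_space Y)
    (f : X -> Y) (cf : continuous f) (sf : set_surj [set: X] [set: Y] f) :
  let f_star : regular_probability R X -> regular_probability R Y :=
    pushforward_regular cX hX hY cf in
  (semi_open f /\ densely_open f -> semi_open f_star /\ densely_open f_star) /\
  (densely_open f -> densely_open f_star).
Proof.
move=> f_star.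
(* The push-forward is open at every measure whose image is atomic with atoms in the set [Y0] of
   continuity points. *)
have lsc (Y0 : set Y) (F : Y -> hyperspace X) :
    (forall y, F y = f @^-1` [set y] :> set X) ->
    (forall y, Y0 y -> {for y, continuous F}) ->
    forall mu (W : set (regular_probability R X)),
    atomic Y0 (f_star mu) -> nbhs mu W -> nbhs (f_star mu) (f_star @` W).
  move=> FE cF mu W [I [b [y [_ _ Yy muP]]]] muW.
  apply: (push_open_at cY sf (S := [seq y i | i <- enum I])) muW.
    move=> _ /mapP[i _ ->] U x oU Ux fx.
    by apply: continuous_fiber_open FE (cF _ (Yy i)) oU _; exists x.
  rewrite muP; last first.
    apply: closed_openC.
    exact: (accessible_finite_set_closed.1 (hausdorff_accessible hY)) (finite_seq _).
  rewrite big1// => i _; rewrite indicE memNset ?mulr0// => /=; apply.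
  by apply: map_f; rewrite mem_enum.
have dense_star : densely_open f -> densely_open f_star.
  move=> [F FE [Y0 dY0 cF]].
  have closed_fib nu : closed (f_star @^-1` [set nu]).
    apply: closed_comp => [mu _|]; first exact: push_continuous.
    exact: accessible_closed_set1 (hausdorff_accessible (weak_star_hausdorff cY hY)) nu.
  have fib0 nu : f_star @^-1` [set nu] !=set0.
    by have [mu _ muE] := push_surj (R := R) cX hX cY hY cf sf (I : setT nu); exists mu.
  exists (fun nu => Hyperspace (closed_fib nu) (fib0 nu)) => //.
  exists (atomic Y0); first exact: atomic_dense.
  move=> nu aY W /nbhs_vietoris[s [os [sub hit] sW]].
  (* Upper semicontinuity comes from closedness of [f_star]: measures outside the union of the sets
     in [s] have a closed image, which misses [nu]. *)
  have upper : nbhs nu (~` (f_star @` (~` (\bigcup_(U in [set` s]) U)))).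
    apply: open_nbhs_nbhs; split.
      apply: closed_openC; apply: (push_closed cY); apply: open_closedC.
      by apply: bigcup_open => U /os.
    by move=> [mu nU muE]; apply: nU; exact: sub.
  (* Lower semicontinuity is where atomicity of [nu] enters, through [lsc] at a point of the fibre
     in each [U]. *)
  have lower : nbhs nu [set nu' | forall U : seq_sub s, (f_star @` (val U)) nu'].
    apply: (@filter_forall _ _ _ _ (nbhs_filter nu)) => U.
    have [mu [muE Umu]] := hit _ (valP U).
    rewrite /= in muE; rewrite -muE; apply: (lsc Y0 F) => //.
      by rewrite muE.
    by apply: open_nbhs_nbhs; split=> //; apply: os; exact: valP.
  apply: (@filterS _ _ (nbhs_filter nu)) (@filterI _ _ (nbhs_filter nu) _ _ upper lower).
  move=> nu' [up low]; apply: sW; split.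
  by move=> mu /= muE; apply: contrapT => nU; apply: up; exists mu.
  move=> U sU; have [mu Umu muE] := low (SeqSub sU).
  by exists mu.
split=> // -[so dof]; split; last exact: dense_star.
move=> W oW W0; have [F FE [Y0 dY0 cF]] := dof.
(* Semi-openness: the image of a non-empty open set has non-empty interior, which meets [Y0]. *)
have dX : dense (f @^-1` Y0).
  move=> U U0 oU; have [y [Uy Yy]] := dY0 _ (so U oU U0) (@open_interior _ _).
  by have [x Ux fx] := interior_subset Uy; exists x; split=> //; rewrite /preimage /= fx.
(* An atomic measure in [W] with atoms over [Y0] has an atomic image, so by [lsc] its image is
   interior to the image of [W]. *)
have [mu [Wmu [I [b [x [b0 b1 Yx muP]]]]]] := atomic_dense cX hX dX W0 oW.
exists (f_star mu); apply: (lsc Y0 F) => //; last exact: open_nbhs_nbhs.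
exists I, b, (f \o x); split=> // U oU; rewrite mass_push muP//.
by move: (cf) => /continuousP; apply.
Qed.
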